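(* Let $N\geq 2$ and $P(X)=X^N-\sum_{j=1}^N b_jX^{N-j}$ be a silver polynomial, with companion matrix \[ U=\begin{pmatrix} b_1&b_2&\cdots&b_{N-1}&b_N\\ 1&0&\cdots&0&0\\ 0&1&\ddots&&\vdots\\ \vdots&&\ddots&0&0\\ 0&\cdots&0&1&0\end{pmatrix}. \] (1) $U$ is primitive if and only if the indices $j\in\{1,\dots,N\}$ with $b_j=1$ have no common divisor greater than $1$. (2) $U$ is not primitive if and only if there exist an integer $d>1$ and a silver polynomial $Q$ whose companion matrix (of the same form) is primitive, such that $P(X)=Q(X^d)$. In this case, if $\sigma$ is the silver number of $P$, then $\sigma^d$ is the silver number of $Q$ (so $\sigma^d$ is a silver number), and $P$ has more than one root of modulus $>1$.
   Context: A silver polynomial of degree $N\geq2$ is $X^N-\sum_{j=1}^Nb_jX^{N-j}$ with all $b_j\in\{0,1\}$, $b_N=1$ and $\sum_j b_j>1$. Its silver number is its largest positive real root. A non-negative real square matrix $A$ is primitive if some positive power $A^m$ has all entries strictly positive. *)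

(* Defs.v *)
From HB Require Import structures.
From mathcomp Require Import all_boot all_order all_algebra.
From mathcomp Require Import polyrcf complex reals.
Set Implicit Arguments.
Unset Strict Implicit.
Unset Printing Implicit Defensive.
Import Order.TTheory GRing.Theory Num.Theory.
Local Open Scope ring_scope.

(* Coefficient families are 1-indexed functions b : nat -> bool, of which only
   the values b 1, ..., b N matter. *)
Definition silver (N : nat) (b : nat -> bool) : bool :=
  [&& (2 <= N)%N, b N & (1 < \sum_(1 <= j < N.+1) b j)%N].

Definition silver_poly (R : nzRingType) (N : nat) (b : nat -> bool) : {poly R} :=
  'X^N - \sum_(1 <= j < N.+1) (b j)%:R *: 'X^(N - j).

(* Rows and columns are 0-indexed, so the first row holds b_1, ..., b_N. *)
Definition silver_companion (R : nzRingType) (N : nat) (b : nat -> bool) :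
    'M[R]_N :=
  \matrix_(i < N, j < N)
    if (i == 0 :> nat)%N then (b j.+1)%:R else (i == j.+1 :> nat)%:R.

Definition primitive_mx (R : numDomainType) (n : nat) (A : 'M[R]_n) : Prop :=
  (forall i j, 0 <= A i j) /\
  exists2 m : nat, (0 < m)%N & forall i j, 0 < (A ^+ m) i j.

Definition largest_pos_root (R : numDomainType) (p : {poly R}) (s : R) : Prop :=
  [/\ 0 < s, root p s & forall x : R, 0 < x -> root p x -> x <= s].

Definition silver_number (R : numDomainType) (s : R) : Prop :=
  exists (N : nat) (b : nat -> bool),
    silver N b /\ largest_pos_root (silver_poly R N b) s.

Lemma silver_number_exists (R : rcfType) (N : nat) (b : nat -> bool) :
  silver N b -> exists s : R, largest_pos_root (silver_poly R N b) s.
Proof.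
case/and3P=> N2 bN sb; set p := silver_poly R N b.
have hE x : p.[x] = x ^+ N - \sum_(1 <= j < N.+1) (b j)%:R * x ^+ (N - j).
  rewrite /p /silver_poly !hornerE horner_sum; congr (_ - _).
  by apply: eq_bigr => j _; rewrite !hornerE.
have p1 : p.[1] < 0.
  rewrite hE expr1n subr_lt0 (eq_bigr (fun j => (b j : nat)%:R)).
    by rewrite -natr_sum ltr1n.
  by move=> j _; rewrite expr1n mulr1.
have p2 : 0 <= p.[2].
  rewrite hE subr_ge0; apply: (@le_trans _ _ (\sum_(1 <= j < N.+1) 2 ^+ (N - j))).
    by apply: ler_sum => j _; case: (b j); rewrite ?mul1r ?mul0r ?exprn_ge0.
  elim: N {N2 bN sb p hE p1} => [|n IH]; first by rewrite big_geq.
  rewrite big_nat_recl //= subn1 /= -[X in _ + X](_ : \sum_(1 <= j < n.+1) 2 ^+ (n - j) = _).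
    by rewrite exprS mulr_natl mulr2n lerD2l.
  by apply: eq_bigr.
have p12 : p.[1] <= 0 <= p.[2] by rewrite (ltW p1).
have [x0 /andP[x0ge _] rx0] := poly_ivt (ler1n _ 2) p12.
have x0gt : 0 < x0 by apply: lt_le_trans x0ge.
have pn0 : p != 0 by apply: contraTneq p1 => ->; rewrite horner0 ltxx.
have memR x : (x \in rootsR p) = root p x.
  by rewrite -(roots_on_rootsR pn0) in_itv.
have [s [ss [s0 rs]]] : exists s : R,
    (forall x, x \in rootsR p -> x <= s) /\ (0 < s /\ root p s).
  have : {subset rootsR p <= root p} by move=> x; rewrite memR.
  elim: (rootsR p) => [|y l IH] sub; first by exists x0.
  have [s [ms [s0 rs]]] := IH (fun x xl => sub x (mem_behead (s := y :: l) xl)).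
  have [ys|sy] := leP y s.
    by exists s; split=> // x; rewrite inE => /orP[/eqP->//|/ms].
  exists y; split; last by split; [exact: lt_trans sy|apply: sub; exact: mem_head].
  by move=> x; rewrite inE => /orP[/eqP->//|/ms xs]; exact: ltW (le_lt_trans xs sy).
by exists s; split=> // x _ rx; apply: ss; rewrite memR.
Qed.

(* Main.v *)
Require Import Defs.
From HB Require Import structures.
From mathcomp Require Import all_boot all_order all_algebra.
From mathcomp Require Import polyrcf complex reals.
From mathcomp Require boolp.
Set Implicit Arguments.
Unset Strict Implicit.
Unset Printing Implicit Defensive.
Import Order.TTheory GRing.Theory Num.Theory.
Local Open Scope ring_scope.

(** The entry (i, j) of U^m is positive iff the graph with edges i -> i - 1
    (for i > 0) and 0 -> j - 1 (for b_j = 1) has a walk of length m from i to j.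
    The loops at 0 have as lengths the sums of indices j with b_j = 1; if these
    indices are coprime, all large lengths occur, and since every vertex reaches
    0 and is reached from 0, U is primitive. If d > 1 divides them all, every
    edge decreases the vertex by 1 modulo d, so a walk from i to j determines
    its length modulo d and U is not primitive.

    In the second case take d to be the gcd of the indices: then P = Q(X^d),
    where Q has the coprime indices j / d. Positive roots of P and Q correspond
    under x |-> x^d. A positive root s of a silver polynomial exceeds 1, and if
    w <> 1 satisfies w^d = 1, then s w is a second root of P of modulus s. *)

(** * Sets of naturals closed under addition *)

Lemma addn_closed_mul (P : nat -> Prop) :
  P 0%N -> (forall m n, P m -> P n -> P (m + n)%N) ->
  forall k n, P n -> P (k * n)%N.
Proof.
by move=> P0 PD k n Pn; elim: k => [|k IH]; rewrite ?mul0n // mulSn; apply: PD.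
Qed.

(* The differences of elements of [P] form a subgroup, whose least positive
   element divides every element of [P], hence is 1. *)
Lemma addn_closed_consecutive (P : nat -> Prop) :
  P 0%N -> (forall m n, P m -> P n -> P (m + n)%N) ->
  (exists2 a, (0 < a)%N & P a) ->
  ~ (exists2 d, (1 < d)%N & forall n, P n -> (d %| n)%N) ->
  exists2 x, P x & P x.+1.
Proof.
move=> P0 PD [a a0 Pa] ncd.
pose G g := exists2 x, P x & P (x + g)%N.
have GP n : P n -> G n by move=> Pn; exists 0%N.
have min n : (0 < n)%N -> G n -> G 1%N.
  elim/ltn_ind: n => n IH n0 Gn.
  have [n1|n1] := leqP n 1.
    by rewrite -(_ : n = 1%N) //; case: n n0 n1 {IH Gn} => [|[]].
  apply: boolp.contrapT => nG1; apply: ncd; exists n => // m Pm.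
  have [x Px Pxn] := Gn; have PM := addn_closed_mul P0 PD.
  have Gr : G (m %% n)%N.
    (* With q = m / n, adding m mod n to q (x + n) gives q x + m, so both numbers lie in [P]. *)
    exists ((m %/ n) * (x + n))%N; first exact: PM.
    rewrite mulnDr -addnA -divn_eq; apply: PD => //; exact: PM.
  rewrite /dvdn; case: posnP => [//|r0]; case: nG1.
  by apply: IH Gr => //; rewrite ltn_mod.
by have [x Px] := min a a0 (GP a Pa); rewrite addn1; exists x.
Qed.

Lemma addn_closed_cofinite (P : nat -> Prop) :
  P 0%N -> (forall m n, P m -> P n -> P (m + n)%N) ->
  (exists2 a, (0 < a)%N & P a) ->
  ~ (exists2 d, (1 < d)%N & forall n, P n -> (d %| n)%N) ->
  exists K, forall n, (K <= n)%N -> P n.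
Proof.
move=> P0 PD Pa ncd; have [x Px Px1] := addn_closed_consecutive P0 PD Pa ncd.
have PM := addn_closed_mul P0 PD; exists (x * x)%N => n xn.
(* If x = 0, then [P] contains x + 1 = 1 and hence every multiple of 1. *)
have [x0|x0] := posnP x.
  by rewrite -[n]muln1; apply: PM; rewrite -x0.
(* n = q x + r with r < x <= q, that is, n = (q - r) x + r (x + 1) *)
have rq : (n %% x <= n %/ x)%N.
  by apply: leq_trans (ltnW (ltn_pmod _ x0)) _; rewrite leq_divRL.
rewrite (divn_eq n x) -{1}(subnK rq) mulnDl -addnA -mulnSr.
by apply: PD; apply: PM.
Qed.

(** * Walks as positive entries of powers of a nonnegative matrix *)

Section NonnegativePowers.
Variables (R : numDomainType) (n : nat) (A : 'M[R]_n).
Hypothesis A0 : forall i j, 0 <= A i j.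

Lemma expmx_ge0 m i j : 0 <= (A ^+ m) i j.
Proof.
elim: m i j => [|m IH] i j; first by rewrite expr0 mxE ler0n.
by rewrite exprS mxE sumr_ge0 // => k _; rewrite mulr_ge0.
Qed.

Lemma expmx_gt0D m1 m2 i k j :
  0 < (A ^+ m1) i k -> 0 < (A ^+ m2) k j -> 0 < (A ^+ (m1 + m2)) i j.
Proof.
move=> ik kj; rewrite exprD mxE (bigD1 k) //= ltr_pwDl ?mulr_gt0 //.
by rewrite sumr_ge0 // => l _; rewrite mulr_ge0 ?expmx_ge0.
Qed.

Lemma expmxS_gt0 m i j : 0 < (A ^+ m.+1) i j ->
  exists k, 0 < A i k /\ 0 < (A ^+ m) k j.
Proof.
move=> Aij.
have /existsP[k /andP[ik kj]] :
    [exists k, (A i k != 0) && ((A ^+ m) k j != 0)].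
  apply: contraTT Aij; rewrite negb_exists => /forallP Aij.
  rewrite exprS mxE big1 ?ltxx // => k _; apply/eqP.
  by have := Aij k; rewrite negb_and !negbK mulf_eq0.
by exists k; rewrite !lt0r ik kj A0 expmx_ge0.
Qed.

End NonnegativePowers.

(** * Walks in the graph of the companion matrix *)

Section SilverCompanion.
Variables (R : numDomainType) (N : nat) (b : nat -> bool).
Local Notation U := (silver_companion R N b).

Lemma silver_companion_ge0 i j : 0 <= U i j.
Proof. by rewrite mxE; case: ifP; rewrite ler0n. Qed.

Lemma silver_companion_gt0 (i j : 'I_N) :
  (0 < U i j) = if (i == 0 :> nat)%N then b j.+1 else (i == j.+1 :> nat).
Proof. by rewrite mxE; case: ifP => _; rewrite ltr0n lt0b. Qed.

Lemma expmx_companion_gt0_mod d m (i j : 'I_N) :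
  (forall j, (1 <= j <= N)%N -> b j -> (d %| j)%N) ->
  0 < (U ^+ m) i j -> (i = j + m %[mod d])%N.
Proof.
move=> db; elim: m i j => [|m IH] i j.
  by rewrite expr0 mxE ltr0n lt0b addn0 => /eqP->.
case/(expmxS_gt0 silver_companion_ge0) => k [ik /IH kj].
rewrite addnS -addn1 -modnDml -kj modnDml addn1; move: ik.
(* An edge 0 -> k requires d to divide k + 1, so it too lowers the vertex by 1 modulo d. *)
rewrite silver_companion_gt0; case: eqP => [->|_ /eqP-> //] bk.
by rewrite mod0n; apply/esym/eqP; apply: db => //; apply: ltn_ord.
Qed.

Lemma companion_descend k (i j : 'I_N) :
  (i = j + k :> nat)%N -> 0 < (U ^+ k) i j.
Proof.
elim: k i => [|k IH] i ijk.
  by rewrite expr0 mxE -val_eqE /= ijk addn0 eqxx ltr01.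
have lt_jk : (j + k < N)%N by rewrite (leq_trans _ (ltn_ord i)) // ijk addnS.
rewrite -[k.+1]add1n.
apply: (expmx_gt0D silver_companion_ge0 (k := Ordinal lt_jk)); last exact: IH.
by rewrite expr1 silver_companion_gt0 /= ijk addnS eqxx.
Qed.

(** One edge leads from 0 to l - 1, and l - 1 - j descents lead on to j. *)
Lemma companion_jump l (i0 j : 'I_N) : i0 = 0%N :> nat ->
  (j < l <= N)%N -> b l -> 0 < (U ^+ (l - j)) i0 j.
Proof.
move=> i00 /andP[jl lN] bl; have l0 : (0 < l)%N by exact: leq_ltn_trans jl.
have ltl : (l.-1 < N)%N by rewrite prednK.
rewrite (_ : l - j = 1 + (l.-1 - j))%N; last first.
  by rewrite add1n -subSn ?prednK // -ltnS prednK.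
apply: (expmx_gt0D silver_companion_ge0 (k := Ordinal ltl)).
  by rewrite expr1 silver_companion_gt0 i00 /= prednK.
by apply: companion_descend; rewrite /= subnKC // -ltnS prednK.
Qed.

Lemma primitive_companionP : (1 < N)%N -> b N ->
  primitive_mx U <->
  ~ (exists2 d, (1 < d)%N &
       forall j, (1 <= j <= N)%N -> b j -> (d %| j)%N).
Proof.
move=> N2 bN; have N0 : (0 < N)%N by exact: ltnW.
pose o := Ordinal N0; split.
  case=> _ [m _ Um] [d d1 db].
  (* The entries (0, 1) and (0, 0) of U^m are both positive, so 0 = 1 + m and 0 = m modulo d, which
     is absurd for d > 1. *)
  have := expmx_companion_gt0_mod db (Um o (Ordinal N2)).
  rewrite /= -modnDmr -(expmx_companion_gt0_mod db (Um o o)) /= modnDmr.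
  by rewrite addn0 mod0n modn_small.
move=> ncd; split; first exact: silver_companion_ge0.
have loop j : (1 <= j <= N)%N -> b j -> 0 < (U ^+ j) o o.
  by move=> jN bj; rewrite -{1}[j]subn0; apply: companion_jump.
have [K KP] : exists K, forall n, (K <= n)%N -> 0 < (U ^+ n) o o.
  apply: addn_closed_cofinite.
  - by rewrite expr0 mxE eqxx ltr01.
  - by move=> m n; apply: expmx_gt0D; exact: silver_companion_ge0.
  - by exists N => //; apply: loop => //; rewrite N0 leqnn.
  - by case=> d d1 dU; apply: ncd; exists d => // j jN /(loop _ jN)/dU.
(* A length that serves all i and j: descend from i to 0 in i steps, loop at 0 for (N - i) + K + j
   >= K steps, then reach j in N - j steps through b_N = 1. *)
exists (N + (K + N))%N => [|i j]; first by rewrite addn_gt0 N0.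
rewrite (_ : N + (K + N) = i + ((N - i) + K + j) + (N - j))%N; last first.
  rewrite -!addnA subnKC ?(ltnW (ltn_ord j)) // !addnA subnKC ?addnA //.
  exact: ltnW.
apply: (expmx_gt0D silver_companion_ge0 (k := o)).
  apply: (expmx_gt0D silver_companion_ge0 (k := o)).
    exact: companion_descend.
  by apply: KP; rewrite addnAC leq_addl.
by apply: companion_jump; rewrite ?ltn_ord ?leqnn.
Qed.

End SilverCompanion.

(** * Coefficients and positive roots of silver polynomials *)

Section SilverPolynomial.
Variables (R : numDomainType) (N : nat) (b : nat -> bool).
Local Notation P := (silver_poly R N b).

Lemma coef_silver_poly_top : P`_N = 1.
Proof.
rewrite coefB coefXn eqxx coef_sum big_nat_cond big1 ?subr0 // => j.
rewrite andbT => /andP[j0 jN]; rewrite coefZ coefXn gtn_eqF ?mulr0 //.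
by rewrite ltn_subrL j0 (leq_trans j0).
Qed.

Lemma coef_silver_poly j : (1 <= j <= N)%N -> P`_(N - j) = - (b j)%:R.
Proof.
move=> /andP[j0 jN].
have ltN k : (0 < k)%N -> (k <= N)%N -> (N - k < N)%N.
  by move=> k0 kN; rewrite ltn_subrL k0 (leq_trans k0).
rewrite coefB coefXn (ltn_eqF (ltN _ _ _)) // sub0r coef_sum.
rewrite (bigD1_seq j) ?mem_index_iota ?iota_uniq ?j0 //=.
rewrite coefZ coefXn eqxx mulr1.
rewrite big_nat_cond big1 ?addr0 // => k /andP[/andP[k0 kN] kj].
rewrite coefZ coefXn; case: eqP => [e|_]; last by rewrite mulr0.
by case/eqP: kj; rewrite -(subKn jN) e subKn.
Qed.

Lemma horner_silver_poly x :
  P.[x] = x ^+ N - \sum_(1 <= j < N.+1) (b j)%:R * x ^+ (N - j).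
Proof.
rewrite /silver_poly !hornerE horner_sum; congr (_ - _).
by apply: eq_bigr => j _; rewrite !hornerE.
Qed.

End SilverPolynomial.

(* If 0 < x <= 1, then every x^(N-j) is at least x^N, and there are at least
   two of them. *)
Lemma silver_pos_root_gt1 (R : realDomainType) N b (x : R) :
  silver N b -> 0 < x -> root (silver_poly R N b) x -> 1 < x.
Proof.
case/and3P=> _ _ sb x0; rewrite /root horner_silver_poly subr_eq0 => /eqP xE.
rewrite ltNge; apply/negP => x1.
have xN0 : 0 < x ^+ N by rewrite exprn_gt0.
have : \sum_(1 <= j < N.+1) (b j)%:R * x ^+ N <= x ^+ N.
  rewrite {2}xE; apply: ler_sum => j _; rewrite ler_wpM2l ?ler0n //.
  by rewrite ler_wiXn2l ?(ltW x0) // leq_subr.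
rewrite -mulr_suml -natr_sum -[leRHS]mul1r ler_pM2r // lern1.
by rewrite leqNgt sb.
Qed.

(** Only exponents divisible by d occur in q(X^d). Both N and N - j occur in P, so d divides their
    difference j. *)
Lemma silver_poly_comp_dvd (R : numDomainType) N b d (q : {poly R}) :
  silver_poly R N b = q \Po 'X^d -> (1 < d)%N ->
  forall j, (1 <= j <= N)%N -> b j -> (d %| j)%N.
Proof.
move=> Pq d1 j jN bj; have d0 : (0 < d)%N by exact: ltnW.
have dP i : (silver_poly R N b)`_i != 0 -> (d %| i)%N.
  by rewrite Pq coef_comp_poly_Xn //; case: ifP; rewrite ?eqxx.
have dN : (d %| N)%N by apply: dP; rewrite coef_silver_poly_top oner_eq0.
have /dP : (silver_poly R N b)`_(N - j) != 0.
  by rewrite coef_silver_poly // bj oppr_eq0 oner_eq0.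
by rewrite dvdn_subr //; case/andP: jN.
Qed.

(** * Substitution of X^d *)

Lemma big_nat_dvd (V : nmodType) d M (F : nat -> V) : (0 < d)%N ->
  (forall j, (1 <= j <= M * d)%N -> ~~ (d %| j)%N -> F j = 0) ->
  \sum_(1 <= j < (M * d).+1) F j = \sum_(1 <= k < M.+1) F (k * d)%N.
Proof.
move=> d0; elim: M => [|M IH] F0; first by rewrite mul0n !big_geq.
rewrite [RHS]big_nat_recr //= -IH; last first.
  move=> j /andP[j0 jM]; apply: F0; rewrite j0 (leq_trans jM) //.
  by rewrite leq_mul2r leqnSn orbT.
rewrite (@big_cat_nat _ _ _ (M * d).+1) //=; last first.
  by rewrite ltnS leq_mul2r leqnSn orbT.
(* In the block M d < j <= (M + 1) d only the last index is a multiple of d. *)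
congr (_ + _); rewrite big_nat_recr /=; last by rewrite mulSn -add1n leq_add2r.
rewrite big_nat_cond big1 ?add0r // => j; rewrite andbT => /andP[jl ju].
apply: F0; first by rewrite (leq_ltn_trans _ jl) //= ltnW.
apply/negP => /dvdnP[k jk]; move: jl ju.
by rewrite jk !ltn_pmul2r // ltnS => /leq_trans le /le; rewrite ltnn.
Qed.

Lemma silver_poly_dilate (R : nzRingType) M (b : nat -> bool) d : (0 < d)%N ->
  (forall j, (1 <= j <= M * d)%N -> b j -> (d %| j)%N) ->
  silver_poly R (M * d) b = silver_poly R M (fun k => b (k * d)%N) \Po 'X^d.
Proof.
move=> d0 db.
rewrite /silver_poly comp_polyB comp_Xn_poly -exprM [(d * M)%N]mulnC.
congr (_ - _); rewrite big_nat_dvd //; last first.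
  by move=> j jM; case: (b j) (db j jM) => [->|_ _] //; rewrite scale0r.
rewrite linear_sum /=; apply: eq_bigr => k _.
by rewrite comp_polyZ comp_Xn_poly -exprM mulnBr ![(d * _)%N]mulnC.
Qed.

Lemma silver_dilate M (b : nat -> bool) d : (0 < d)%N ->
  (forall j, (1 <= j <= M * d)%N -> b j -> (d %| j)%N) ->
  silver (M * d) b -> silver M (fun k => b (k * d)%N).
Proof.
move=> d0 db /and3P[_ bM sb].
have s : (1 < \sum_(1 <= k < M.+1) b (k * d)%N)%N.
  rewrite -(@big_nat_dvd nat _ _ (fun j => b j : nat)) // => j jM.
  by case: (b j) (db j jM) => [->|] //.
(* The degree bound M >= 2 comes from the count: M bits have sum at most M. *)
rewrite /silver bM s !andbT; apply: leq_trans s _.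
apply: (@leq_trans (\sum_(1 <= k < M.+1) 1)).
  by apply: leq_sum => k _; case: (b _).
by rewrite sum_nat_const_nat subn1 muln1.
Qed.

(** * Roots under the map x |-> x^d *)

Lemma exists_nth_root (R : rcfType) d (x : R) : (0 < d)%N -> 0 < x ->
  exists2 y, 0 < y & y ^+ d = x.
Proof.
move=> d0 x0; pose p : {poly R} := 'X^d - x%:P.
have pE y : p.[y] = y ^+ d - x by rewrite !hornerE.
have x1 : 1 <= 1 + x by rewrite lerDl ltW.
(* The polynomial changes sign on [0, 1 + x], since (1 + x)^d >= 1 + x >= x. *)
have [||y /andP[y0 _] /rootP] := @poly_ivt _ p 0 (1 + x).
- exact: le_trans x1.
- rewrite !pE expr0n eqn0Ngt d0 sub0r oppr_le0 (ltW x0) subr_ge0.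
  by rewrite (le_trans _ (ler_eXnr d0 x1)) // lerDr.
rewrite pE => /eqP; rewrite subr_eq0 => /eqP yx; exists y => //.
rewrite lt0r y0 andbT; apply: contraTneq x0 => y0E.
by rewrite -yx y0E expr0n eqn0Ngt d0 ltxx.
Qed.

(** A positive root x of q has a positive d-th root y, which is a root of q(X^d); so y <= s, and x =
    y^d <= s^d. *)
Lemma largest_pos_root_comp_Xn (R : rcfType) d (q : {poly R}) s : (0 < d)%N ->
  largest_pos_root (q \Po 'X^d) s -> largest_pos_root q (s ^+ d).
Proof.
move=> d0 [s0 rs smax]; split; first by rewrite exprn_gt0.
  by move: rs; rewrite /root horner_comp hornerXn.
move=> x x0 rx; have [y y0 yx] := exists_nth_root d0 x0.
rewrite -yx lerXn2r ?nnegrE ?(ltW y0) ?(ltW s0) // smax //.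
by rewrite /root horner_comp hornerXn yx.
Qed.

(** A root of 1 + X + ... + X^(d-1) = (X^d - 1) / (X - 1) serves as w; it is not 1, because the
    value at 1 is d. *)
Lemma exists_nontrivial_unity_root (C : numClosedFieldType) d : (1 < d)%N ->
  exists2 w : C, w != 1 & w ^+ d = 1.
Proof.
move=> d1; pose p : {poly C} := \poly_(i < d) 1.
have pE : p = \sum_(i < d) 'X^i.
  by rewrite /p poly_def; apply: eq_bigr => i _; rewrite scale1r.
have /closed_rootP[w /rootP pw] : size p != 1%N.
  by rewrite size_poly_eq ?oner_eq0 // gtn_eqF.
exists w.
  apply: contra_eq_neq pw => ->; rewrite pE horner_sum.
  under eq_bigr do rewrite hornerXn expr1n.
  by rewrite sumr_const card_ord pnatr_eq0 -lt0n ltnW.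
apply/eqP; rewrite -subr_eq0 subrX1.
move: pw; rewrite pE horner_sum; under eq_bigr do rewrite hornerXn.
by move->; rewrite mulr0.
Qed.

Theorem theorem4p1 (R : realType) (N : nat) (b : nat -> bool)
    (hP : silver N b) :
  (primitive_mx (silver_companion R N b) <->
     ~ (exists2 d : nat, (1 < d)%N &
          forall j : nat, (1 <= j <= N)%N -> b j -> (d %| j)%N)) /\
  ((~ primitive_mx (silver_companion R N b) <->
      exists (d M : nat) (c : nat -> bool),
        [/\ (1 < d)%N, silver M c, primitive_mx (silver_companion R M c) &
            silver_poly R N b = silver_poly R M c \Po 'X^d]) /\
   (forall (d M : nat) (c : nat -> bool),
      (1 < d)%N -> silver M c -> primitive_mx (silver_companion R M c) ->
      silver_poly R N b = silver_poly R M c \Po 'X^d ->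
      (forall s : R, largest_pos_root (silver_poly R N b) s ->
         largest_pos_root (silver_poly R M c) (s ^+ d) /\
         silver_number (s ^+ d)) /\
      (exists z1 z2 : R[i],
         [/\ z1 != z2,
             root (map_poly (real_complex R) (silver_poly R N b)) z1,
             root (map_poly (real_complex R) (silver_poly R N b)) z2,
             1 < `|z1| & 1 < `|z2|]))).
Proof.
have primP n c : silver n c -> _ :=
  fun h => let: And3 h1 h2 _ := and3P h in @primitive_companionP R n c h1 h2.
split; first exact: primP.
split; last first.
  move=> d M c d1 hQ _ PQ; have d0 : (0 < d)%N by exact: ltnW.
  split=> [s|].
    rewrite PQ => /(largest_pos_root_comp_Xn d0) hs; split => //.
    by exists M, c.
  have [s [s0 rs _]] := silver_number_exists R hP.
  have s1 := silver_pos_root_gt1 hP s0 rs.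
  have [w w1 wd] := @exists_nontrivial_unity_root R[i] d d1.
  have nw : `|w| = 1.
    by apply/eqP; rewrite -(@pexpr_eq1 _ _ d) ?normr_ge0 // -normrX wd normr1.
  have ns : 1 < `|s%:C%C|.
    by rewrite ger0_norm ?ler0c ?(ltW s0) // ltcR.
  have rsC : root (map_poly (real_complex R) (silver_poly R N b)) s%:C%C.
    exact: rmorph_root.
  exists s%:C%C, (s%:C%C * w); split => //.
  - apply: contra w1 => /eqP e; apply/eqP/(@mulfI _ s%:C%C).
      by rewrite -normr_gt0 (lt_trans ltr01).
    by rewrite mulr1.
  (* [s] and [s * w] have the same d-th power, so Q(X^d) takes the same value at both. *)
  - move: rsC; rewrite PQ map_comp_poly map_polyXn /root !horner_comp !hornerXn.
    by rewrite exprMn wd mulr1.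
  - by rewrite normrM nw mulr1.
have /and3P[N2 bN _] := hP.
split; last first.
  move=> [d [M [c [d1 _ _ PQ]]]] /(primP _ _ hP); apply; exists d => //.
  exact: silver_poly_comp_dvd PQ d1.
(* The range includes j = 0, which is harmless because 0 is neutral for the gcd. *)
move=> nprim; pose g := (\big[gcdn/0%N]_(j < N.+1 | b j) j)%N.
have gP d : (forall j, (1 <= j <= N)%N -> b j -> (d %| j)%N) <-> (d %| g)%N.
  split=> [db|dg j /andP[_ jN] bj].
    apply/dvdn_biggcdP => -[[|j] jN] //= bj; exact: db.
  by have /dvdn_biggcdP/(_ (Ordinal (jN : j < N.+1)%N) bj) := dg.
have gb := (gP g).2 (dvdnn g).
have gN : (g %| N)%N by apply: gb => //; rewrite leqnn ltnW.
have g0 : (0 < g)%N by rewrite (dvdn_gt0 _ gN) // ltnW.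
have g1 : (1 < g)%N.
  rewrite ltn_neqAle g0 andbT; apply/eqP => g1; apply: nprim.
  apply/(primP _ _ hP) => -[d d1 /gP]; rewrite -g1 dvdn1 => /eqP dE.
  by rewrite dE in d1.
have NE : N = (N %/ g * g)%N by rewrite divnK.
have sM : silver (N %/ g) (fun k => b (k * g)%N).
  by apply: silver_dilate; rewrite -?NE.
exists g, (N %/ g)%N, (fun k => b (k * g)%N); split=> //; last first.
  by rewrite {1}NE; apply: silver_poly_dilate; rewrite -?NE.
(* a common divisor e of the dilated indices makes e * g divide g *)
apply/(primP _ _ sM) => -[e e1 eb].
have /gP : forall j, (1 <= j <= N)%N -> b j -> (e * g %| j)%N.
  move=> j jN bj; have /dvdnP[k jk] := gb j jN bj; rewrite jk in jN bj *.
  rewrite dvdn_pmul2r // eb //; case/andP: jN => k0 kN.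
  by rewrite leq_divRL // kN andbT; case: k k0 {jk bj kN}.
by move/(dvdn_leq g0); rewrite leqNgt ltn_Pmull.
Qed.
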